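(* Let $m$ be a positive integer and $0<q<1$, and suppose $m$ elements are selected independently, each with probability $q$. Then for every $\varepsilon$ with $0\le\varepsilon<\frac{1-q}{q}$, the probability that exactly $\lceil qm(1+\varepsilon)\rceil$ elements are selected is at least $c\,q\,m^{-3/2}\exp\left[\frac{-\varepsilon^2qm}{1-q}\right]$, where $c=\frac{1}{4\sqrt{2\pi}}$. *)

(* Defs.v *)
From HB Require Export structures.
From mathcomp Require Export all_boot all_order all_algebra.
From mathcomp Require Export all_classical all_reals all_analysis.

Set Implicit Arguments.
Unset Strict Implicit.
Unset Printing Implicit Defensive.

Export Order.TTheory GRing.Theory Num.Theory.
Export numFieldNormedType.Exports.

Local Open Scope classical_set_scope.
Local Open Scope ring_scope.

(* For J empty the condition reads P setT = 1. *)
Definition mutually_independent (d : measure_display) (T : measurableType d)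
    (R : realType) (P : probability T R) (I : finType) (A : I -> set T) : Prop :=
  (forall i, measurable (A i)) /\
  forall J : {set I},
    P (\bigcap_(i in [set` J]) A i) = (\prod_(i in J) P (A i))%E.

(* A i is the event that the element i is selected; selected A w is the set of
   the elements selected in the outcome w. *)
Definition selected (T : Type) (I : finType) (A : I -> set T) (w : T) :
    {set I} :=
  finset (fun i => w \in A i).

(* Main.v *)
Require Import Defs.
From mathcomp Require Import ring lra zify.

(** Put [x = q m (1 + eps)], [p = x / m], [k] the ceiling of [x] and
    [r = k / (m + 1)].  From [ln t <= t - 1] one gets, for every [r],
    [exp (- eps^2 q m / (1 - q)) <= (q / r)^x ((1 - q) / (1 - r))^(m - x)], and
    replacing [x] by [k] on the right costs at most the factor [m / q].  It
    remains to bound the binomial weight ['C(m, k) r^k (1 - r)^(m - k)] from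
    below.  The choice of [r] makes it equal to
    [F(k, j) = 'C(k + j, k) k^k j^j / (k + j)^(k + j)] with [j = m + 1 - k].
    As [(1 + 1/n)^n] is nondecreasing, [F] is nonincreasing in each argument,
    and [k, j <= m], so [F(k, j) >= F(m, m) = 'C(2m, m) / 4^m >= 1 / (2 sqrt m)]. *)

Local Open Scope classical_set_scope.
Local Open Scope ring_scope.

(** * Monotonicity of [(1 + 1/n)^n] *)

Lemma bernoulli_inequality {R : realFieldType} {x : R} (n : nat) :
  -1 <= x -> 1 + n%:R * x <= (1 + x) ^+ n.
Proof.
move=> x_ge; elim: n => [|n IHn]; first by rewrite mul0r addr0 expr0.
rewrite exprS -natr1.
have x1_ge0 : 0 <= 1 + x by lra.
apply: le_trans (ler_wpM2l x1_ge0 IHn).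
have := mulr_ge0 (ler0n R n) (sqr_ge0 x); nra.
Qed.

Lemma compound_gt0 {R : realFieldType} (n : nat) :
  0 < (n.+1%:R / n%:R : R) ^+ n.
Proof. by case: n => [|n]; rewrite ?expr0 // exprn_gt0 // divr_gt0. Qed.

(** For [a = n + 1], Bernoulli's inequality with exponent [a + 1] and [x = - 1 / (a + 1)^2] has left
    side [a / (a + 1)], while [1 + x] is the quotient of the bases [(a + 2) / (a + 1)] and
    [(a + 1) / a]. Cancelling one factor [a / (a + 1)] leaves the comparison of consecutive
    terms. *)
Lemma compound_nondecreasing (R : realFieldType) :
  {homo (fun n : nat => (n.+1%:R / n%:R : R) ^+ n) : m n / (m <= n)%N >-> m <= n}.
Proof.
apply: homo_leq => [//|y x z|n]; first exact: le_trans.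
(* At index 0 the term is a zeroth power, hence 1, although its base divides by zero. *)
case: n => [|n]; first by rewrite expr0 expr1 divr1 (ler_nat _ 1).
set a : R := n.+1%:R.
have a_gt0 : 0 < a by rewrite ltr0n.
have n2E : n.+2%:R = a + 1 by rewrite -natr1.
have n3E : n.+3%:R = a + 2 by rewrite -addn2 natrD.
rewrite n3E n2E; clearbody a.
have a1_neq0 : a + 1 != 0 by lra.
have a_neq0 : a != 0 by lra.
have x_ge : -1 <= - ((a + 1) ^+ 2)^-1.
  rewrite lerN2 invf_le1 ?exprn_gt0 ?expr_ge1 //; nra.
have := bernoulli_inequality n.+2 x_ge; rewrite n2E.
have -> : 1 + (a + 1) * - ((a + 1) ^+ 2)^-1 = ((a + 1) / a)^-1.
  by field; rewrite a_neq0 a1_neq0.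
have -> : 1 - ((a + 1) ^+ 2)^-1 = (a + 2) / (a + 1) * ((a + 1) / a)^-1.
  by field; rewrite a_neq0 a1_neq0.
rewrite exprMn [((a + 1) / a)^-1 ^+ _]exprS exprVn mulrCA.
have c_gt0 : 0 < (a + 1) / a by rewrite divr_gt0 // addr_gt0.
rewrite -{1}[_^-1]mulr1 ler_pM2l ?invr_gt0 //.
by rewrite ler_pdivlMr ?exprn_gt0 // mul1r.
Qed.

(** * The modal binomial mass and its lower bound *)

(* The probability of exactly [k] successes in [k + j] independent trials of
   success probability [k / (k + j)]. *)
Definition modal_mass (R : realFieldType) (k j : nat) : R :=
  'C(k + j, k)%:R * k%:R ^+ k * j%:R ^+ j / (k + j)%:R ^+ (k + j).

Lemma modal_massC (R : realFieldType) (k j : nat) :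
  modal_mass R k j = modal_mass R j k.
Proof.
rewrite /modal_mass [(j + k)%N]addnC -[in LHS]bin_sub ?leq_addr // addKn.
congr (_ / _); exact: mulrAC.
Qed.

Lemma modal_mass_ge0 (R : realFieldType) (k j : nat) : 0 <= modal_mass R k j.
Proof. by rewrite /modal_mass divr_ge0 ?mulr_ge0 ?exprn_ge0. Qed.

(** With [e_n = (1 + 1/n)^n], the ratio of consecutive values is [e_j / e_(k+j)], so the
    monotonicity of [e] makes it at most 1. The binomial coefficients contribute
    [(k + j + 1) / (j + 1)], which absorbs the extra factor of each power. *)
Lemma modal_massS (R : realFieldType) (k j : nat) : (0 < k)%N ->
  modal_mass R k j.+1 = modal_mass R k j *
    ((j.+1%:R / j%:R) ^+ j / ((k + j).+1%:R / (k + j)%:R) ^+ (k + j)).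
Proof.
move=> k_gt0; rewrite /modal_mass addnS.
have n_neq0 : (k + j)%:R != 0 :> R by rewrite pnatr_eq0; lia.
have n1_neq0 : (k + j).+1%:R != 0 :> R by rewrite pnatr_eq0.
have j1_neq0 : j.+1%:R != 0 :> R by rewrite pnatr_eq0.
have binE : j.+1%:R * 'C((k + j).+1, k)%:R = (k + j).+1%:R * 'C(k + j, k)%:R :> R.
  rewrite -!natrM mul_bin_down; congr (_ * _)%:R; lia.
(* For [j = 0] both sides are 1, by the convention on zeroth powers. *)
have -> : j.+1%:R ^+ j.+1 = j.+1%:R * (j.+1%:R / j%:R) ^+ j * j%:R ^+ j :> R.
  case: j {n_neq0 n1_neq0 binE} j1_neq0 => [|j] _; first by rewrite !expr0 expr1 !mulr1.
  by rewrite exprS -mulrA -exprMn divfK // pnatr_eq0.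
rewrite [(k + j).+1%:R ^+ _]exprS [((k + j).+1%:R / _) ^+ _]expr_div_n.
have := expf_neq0 (k + j) n_neq0; have := expf_neq0 (k + j) n1_neq0.
set N1 := _ ^+ _ => N1_neq0; set N := _ ^+ _ => N_neq0.
set e := (_ / _) ^+ j.
transitivity (j.+1%:R * 'C((k + j).+1, k)%:R * (k%:R ^+ k * e * j%:R ^+ j)
  / ((k + j).+1%:R * N1)); first by congr (_ / _); ring.
rewrite binE; clearbody e N N1; move: (k + j).+1%:R n1_neq0 => M M_neq0.
by field; rewrite N_neq0 N1_neq0 M_neq0.
Qed.

Lemma modal_mass_nonincreasing (R : realFieldType) (k i j : nat) : (0 < k)%N ->
  (i <= j)%N -> modal_mass R k j <= modal_mass R k i.
Proof.
move=> k_gt0; elim: j => [|j IHj]; first by rewrite leqn0 => /eqP->.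
rewrite leq_eqVlt => /predU1P[->//|le_ij]; apply: le_trans (IHj le_ij).
rewrite modal_massS // ler_piMr ?modal_mass_ge0 //.
rewrite ler_pdivrMr ?compound_gt0 // mul1r.
exact: (compound_nondecreasing R _ _ (leq_addl k j)).
Qed.

Lemma modal_mass_diag (R : realFieldType) (n : nat) : (0 < n)%N ->
  modal_mass R n n = 'C(n.*2, n)%:R / 4 ^+ n.
Proof.
move=> n_gt0; rewrite /modal_mass addnn.
have n_neq0 : n%:R != 0 :> R by rewrite pnatr_eq0; lia.
have -> : n.*2%:R ^+ n.*2 = 4 ^+ n * n%:R ^+ n * n%:R ^+ n :> R.
  rewrite -!exprMn -muln2 natrM mulnC exprM; congr (_ ^+ _); ring.
have := expf_neq0 n n_neq0; set N := _ ^+ n => N_neq0.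
have := expf_neq0 n (_ : 4 != 0 :> R); set F := _ ^+ n => F_neq0.
by field; rewrite N_neq0 F_neq0 ?pnatr_eq0.
Qed.

(** Induction through [(n + 1) C(2n + 2, n + 1) = 2 (2n + 1) C(2n, n)]: after multiplication by
    [n + 1], the step reduces to [4 n (n + 1) <= (2n + 1)^2]. Squaring keeps the bound inside the
    natural numbers. *)
Lemma central_binomial_ge (n : nat) : (0 < n)%N ->
  (16 ^ n <= 4 * n * 'C(n.*2, n) ^ 2)%N.
Proof.
elim: n => // -[_ _|n IHn _]; first by [].
have {}IHn := IHn isT.
have b1 : (n.+2 * 'C(n.+2.*2, n.+2) = 2 * (n.*2 + 3) * 'C(n.+1.*2, n.+1))%N.
  have h1 := mul_bin_diag n.+1.*2.+2 n.+1.
  have h2 := mul_bin_down n.+1.*2.+1 n.+1.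
  have E : (n.+1.*2.+1 - n.+1 = n.+2)%N by lia.
  rewrite E /= in h2.
  have h3 : (n.+2 * (n.+2 * 'C(n.+2.*2, n.+2)) =
      n.+2 * (2 * (n.*2 + 3) * 'C(n.+1.*2, n.+1)))%N.
    rewrite [in LHS]doubleS -h1 mulnCA -h2; nia.
  by apply/eqP; rewrite -(eqn_pmul2l (ltn0Sn n.+1)) h3.
rewrite -(leq_pmul2l (ltn0Sn n.+1)) expnS; nia.
Qed.

Lemma modal_mass_ge (R : rcfType) (k j m : nat) :
  (0 < k <= m)%N -> (0 < j <= m)%N ->
  (2 * Num.sqrt m%:R)^-1 <= modal_mass R k j.
Proof.
move=> /andP[k_gt0 k_le] /andP[j_gt0 j_le].
have m_gt0 : (0 < m)%N by lia.
(* Raise [j] to [m], swap the arguments, then raise [k] to [m]. *)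
apply: le_trans (modal_mass_nonincreasing R _ _ _ k_gt0 j_le).
rewrite modal_massC.
apply: le_trans (modal_mass_nonincreasing R _ _ _ m_gt0 k_le).
rewrite modal_mass_diag //.
have s_gt0 : 0 < Num.sqrt m%:R :> R by rewrite sqrtr_gt0 ltr0n.
rewrite ler_pdivlMr ?exprn_gt0 // mulrC ler_pdivrMr ?mulr_gt0 //.
rewrite -(@ler_pXn2r _ 2) ?nnegrE ?exprn_ge0 ?mulr_ge0 ?sqrtr_ge0 //.
rewrite !exprMn sqr_sqrtr // -exprM mulnC exprM.
have := central_binomial_ge _ m_gt0; rewrite -(ler_nat R) !natrM !natrX.
have -> : 4 ^+ 2 = 16 :> R by ring.
by move=> /le_trans; apply; rewrite le_eqVlt; apply/orP; left; apply/eqP; ring.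
Qed.

(** * The law of the number of selected elements *)

(** Independence is given for intersections of the [A i] only; complements enter one at a time. For
    [i] in [K], let [G] be the event of [J] and [K :\ i]. Then
    [P (G minus A i) = P G - P (G and A i)], and the last event belongs to [i |: J] and [K :\ i].
    The induction is on [#|K|] with [J] free, since [J] grows. *)
Lemma independent_complements {R : realType} {d : measure_display}
    {T : measurableType d} {P : probability T R} {I : finType} {q : R}
    {A : I -> set T} (hA : mutually_independent P A)
    (hAq : forall i, P (A i) = q%:E) (K J : {set I}) : [disjoint J & K]%B ->
  let G := \bigcap_(i in [set` J]) A i `&` \bigcap_(i in [set` K]) ~` A i in
  measurable G /\ P G = (q ^+ #|J| * (1 - q) ^+ #|K|)%:E.
Proof.
case: hA => A_meas A_ind; have [n] := ubnP #|K|; elim: n K J => // n IHn K J.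
move=> K_lt JK /=; split.
  by apply: measurableI; apply: fin_bigcap_measurable => // i _; exact: measurableC.
have [->|[i iK]] := set_0Vmem K.
  rewrite [X in _ `&` X](_ : _ = setT) ?setIT; last first.
    by apply/seteqP; split => // w _ i /=; rewrite inE.
  rewrite A_ind cards0 expr0 mulr1 (eq_bigr (fun=> q%:E)) => [|i _]; last exact: hAq.
  by rewrite prodEFin prodr_const.
have iJ : i \notin J by apply: contraTN iK => iJ; rewrite (disjointFr JK).
have card_K : #|K| = #|K :\ i|%N.+1 by rewrite (cardsD1 i K) iK.
have card_iJ : #|i |: J| = #|J|.+1 by rewrite cardsU1 iJ.
have JKi : [disjoint J & K :\ i]%B.
  by apply: disjointWr JK; exact: subsetDl.
have iJKi : [disjoint i |: J & K :\ i]%B.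
  rewrite disjoint_sym finset.disjoints_subset; apply/fintype.subsetP => j.
  by rewrite !inE => /andP[ji jK]; rewrite (negPf ji) (disjointFl JK).
have K_lt' : (#|K :\ i| < n)%N by move: K_lt; rewrite card_K ltnS.
have [/= G_meas PG] := IHn _ _ K_lt' JKi.
have [/= _ PG'] := IHn _ _ K_lt' iJKi.
set G := _ `&` _ in G_meas PG.
have : P G = (P (G `\` A i) + P (G `&` A i))%E := measureDI P G_meas (A_meas i).
rewrite PG [X in (_ + P X)%E](_ : _ = \bigcap_(j in [set` i |: J]) A j `&`
    \bigcap_(j in [set` K :\ i]) ~` A j); last first.
  apply/seteqP; split => [w [[wJ wK] wi]|w [wiJ wK]].
    by split=> // j /=; rewrite !inE => /predU1P[->//|jJ]; exact: wJ.
  split; last by apply: wiJ; rewrite /= !inE eqxx.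
  by split=> // j jJ; apply: wiJ; rewrite /= !inE; apply/orP; right.
rewrite PG' [X in (P X + _)%E](_ : _ = \bigcap_(j in [set` J]) A j `&`
    \bigcap_(j in [set` K]) ~` A j); last first.
  apply/seteqP; split => [w [[wJ wK] wi]|w [wJ wK]].
    split=> // j /= jK; have [->//|ji] := eqVneq j i.
    by apply: wK; rewrite /= !inE ji.
  split; last exact: wK.
  by split=> // j /=; rewrite !inE => /andP[_ jK]; exact: wK.
move/eqP; rewrite -sube_eq ?fin_num_adde_defl // => /eqP <-.
rewrite -EFinB card_K card_iJ !exprS; congr (_%:E); ring.
Qed.

Lemma selected_bigcap {T : Type} {I : finType} (A : I -> set T) (S : {set I}) :
  [set w | selected A w = S] =
  \bigcap_(i in [set` S]) A i `&` \bigcap_(i in [set` ~: S]) ~` A i.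
Proof.
apply/seteqP; split => [w /= <-|w [wS wCS] /=].
  split=> i /=; first by rewrite inE => /set_mem.
  by rewrite !inE => /negP wi wi'; apply: wi; exact/mem_set.
apply/setP => i; rewrite inE; apply/idP/idP => [/set_mem wi|iS].
  by apply: contraPT wi => iS; apply: wCS; rewrite /= inE.
by apply/mem_set; exact: wS.
Qed.

(** The event is the disjoint union, over the sets [S] of size [k], of the events that exactly [S]
    is selected; these are equiprobable, and there are ['C(#|I|, k)] of them. *)
Lemma probability_card_selected {R : realType} {d : measure_display}
    {T : measurableType d} {P : probability T R} {I : finType} {q : R}
    {A : I -> set T} (hA : mutually_independent P A)
    (hAq : forall i, P (A i) = q%:E) (k : nat) :
  P [set w | #|selected A w| = k] =
  ('C(#|I|, k)%:R * (q ^+ k * (1 - q) ^+ (#|I| - k)))%:E.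
Proof.
pose D := [set S : {set I} | #|S| == k]%SET.
have atom S : let B := [set w | selected A w = S] in measurable B /\
    P B = (q ^+ #|S| * (1 - q) ^+ #|~: S|)%:E.
  rewrite selected_bigcap; apply: independent_complements => //.
  by rewrite finset.disjoints_subset finset.setCK.
rewrite (_ : [set w | _] = \bigcup_(S in [set` enum D])
    [set w | selected A w = S]); last first.
  apply/seteqP; split => [w /= wk|w [S /=]].
    by exists (selected A w) => //=; rewrite mem_enum inE wk.
  by rewrite mem_enum inE => /eqP <- ->.
rewrite measure_fin_bigcup //; last 2 first.
- by move=> S S' _ _ [w [/= -> ->]].
- by move=> S _; case: (atom S).
rewrite -(fsbig_seq _ _ (enum_uniq _)) big_enum /=.
rewrite (eq_bigr (fun=> (q ^+ k * (1 - q) ^+ (#|I| - k))%:E)); last first.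
  move=> S; rewrite inE => /eqP Sk; have [_ ->] := atom S.
  by rewrite -Sk -(cardsC S) addKn.
by rewrite sumEFin sumr_const -card_draws mulr_natl.
Qed.

(** * Changing the parameter of the binomial weight from [q] to [r] *)

Lemma ln_ratio_le {R : realType} {a b : R} : 0 < a -> 0 < b ->
  ln a - ln b <= a / b - 1.
Proof.
move=> a_gt0 b_gt0; rewrite -ln_div ?posrE //.
have ab_gt0 : 0 < a / b by rewrite divr_gt0.
by rewrite -{1}[a / b](subrKC 1) le_ln1Dx // ltrBrDr addrC subrr.
Qed.

(* Writing p = q (1 + eps), the logarithms on the left are split through p:
   the terms comparing q with p add up to the chi-square divergence of p from q,
   and those comparing p with r cancel. *)
Lemma log_likelihood_ratio_le {R : realType} {q r eps : R} :
  0 < q < 1 -> 0 < r < 1 -> 0 <= eps -> q * (1 + eps) < 1 ->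
  q * (1 + eps) * (ln r - ln q) +
  (1 - q * (1 + eps)) * (ln (1 - r) - ln (1 - q)) <= eps ^+ 2 * q / (1 - q).
Proof.
move=> /andP[q_gt0 q_lt1] /andP[r_gt0 r_lt1] eps_ge0 p_lt1.
have q1_gt0 : 0 < 1 - q by lra.
have r1_gt0 : 0 < 1 - r by lra.
have e1_gt0 : 0 < 1 + eps by lra.
pose p := q * (1 + eps); rewrite -/p in p_lt1 *.
have p_gt0 : 0 < p by rewrite mulr_gt0.
have p1_gt0 : 0 < 1 - p by lra.
have h1 := ler_wpM2l (ltW p_gt0)
  (lerD (ln_ratio_le r_gt0 p_gt0) (ln_ratio_le p_gt0 q_gt0)).
have h2 := ler_wpM2l (ltW p1_gt0)
  (lerD (ln_ratio_le r1_gt0 p1_gt0) (ln_ratio_le p1_gt0 q1_gt0)).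
have [q_neq0 q1_neq0] : q != 0 /\ 1 - q != 0 by split; lra.
have [p_neq0 p1_neq0] : p != 0 /\ 1 - p != 0 by split; lra.
have e1 : p * (r / p - 1 + (p / q - 1)) = r - p + p * (p / q - 1)
  by field; rewrite ?p_neq0 ?q_neq0.
have e2 : (1 - p) * ((1 - r) / (1 - p) - 1 + ((1 - p) / (1 - q) - 1)) =
   p - r + (1 - p) * ((1 - p) / (1 - q) - 1) by field; rewrite ?p1_neq0 ?q1_neq0.
have e3 : p * (p / q - 1) + (1 - p) * ((1 - p) / (1 - q) - 1) = eps ^+ 2 * q / (1 - q).
  by rewrite /p; field; rewrite ?q_neq0 ?q1_neq0.
have e4 (u v w : R) : u - v + (v - w) = u - w by ring.
rewrite e1 e4 in h1; rewrite e2 e4 in h2.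
by have := lerD h1 h2; rewrite -e3; lra.
Qed.

(** After taking logarithms, [m] times the preceding inequality is the claim with the real exponent
    [x = q m (1 + eps)] in place of [k], without the factors [m] and [q]. These pay for rounding [x]
    up to [k]. The denominator [m.+1] keeps [r < 1] even when [k = m]. *)
Lemma binomial_weight_change_of_parameter_le {R : realType} {m k : nat} {q r eps : R} :
  0 < q < 1 -> 0 <= eps -> q * (1 + eps) < 1 ->
  (0 < k <= m)%N -> k%:R - 1 <= q * m%:R * (1 + eps) <= k%:R ->
  r = k%:R / m.+1%:R ->
  q * expR (- (eps ^+ 2 * q * m%:R) / (1 - q)) * (r ^+ k * (1 - r) ^+ (m - k))
  <= m%:R * (q ^+ k * (1 - q) ^+ (m - k)).
Proof.
move=> q01 eps_ge0 p_lt1 /andP[k_gt0 k_le] /andP[x_gt x_le] rE.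
have [q_gt0 q_lt1] := andP q01.
have m_gt0 : (0 < m)%N by exact: leq_trans k_le.
have j_gt0 : (0 < m.+1 - k)%N by rewrite subn_gt0 ltnS.
have q1_gt0 : 0 < 1 - q by lra.
have kR_gt0 : 0 < k%:R :> R by rewrite ltr0n.
have mR_gt0 : 0 < m%:R :> R by rewrite ltr0n.
have mR_ge1 : 1 <= m%:R :> R by rewrite (ler_nat _ 1).
have jR_ge1 : 1 <= (m.+1 - k)%:R :> R by rewrite (ler_nat _ 1).
have jE : (m.+1 - k)%:R = m%:R + 1 - k%:R :> R.
  by rewrite natrB ?leqW // -natr1.
have nE : m.+1%:R = m%:R + 1 :> R by rewrite -natr1.
have n_gt0 : 0 < m%:R + 1 :> R by lra.
have r_gt0 : 0 < r by rewrite rE divr_gt0.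
have r1E : 1 - r = (m.+1 - k)%:R / m.+1%:R.
  rewrite rE jE nE; field; lra.
have r1_gt0 : 0 < 1 - r by rewrite r1E divr_gt0 // ltr0n.
have r01 : 0 < r < 1 by rewrite r_gt0; lra.
have llr := log_likelihood_ratio_le q01 r01 eps_ge0 p_lt1.
(* The odds [r / (1 - r)] equal [k / (m + 1 - k)], which is at most [m]. *)
have odds_le : ln r - ln (1 - r) <= ln m%:R.
  rewrite r1E rE !ln_div ?posrE ?ltr0n //.
  have : ln (k%:R : R) <= ln m%:R by rewrite ler_ln ?posrE // ler_nat.
  have : 0 <= ln ((m.+1 - k)%:R : R) by rewrite ln_ge0.
  lra.
have lnm_ge0 : 0 <= ln (m%:R : R) by rewrite ln_ge0.
have lnq_le0 : ln q <= 0 by rewrite ln_le0 // ltW.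
have lnq1_le0 : ln (1 - q) <= 0 by rewrite ln_le0 //; lra.
have lnX a b : 0 < a :> R -> 0 < b :> R ->
    ln (a ^+ k * b ^+ (m - k)) = k%:R * ln a + (m%:R - k%:R) * ln b.
  move=> a0 b0; rewrite lnM ?posrE ?exprn_gt0 // !lnXn // -natrB //.
  by rewrite !mulr_natl.
rewrite -ler_ln ?posrE ?mulr_gt0 ?expR_gt0 ?exprn_gt0 //.
rewrite lnM ?posrE ?mulr_gt0 ?expR_gt0 ?exprn_gt0 // lnM ?posrE ?expR_gt0 // expRK.
rewrite [ln (m%:R * _)]lnM ?posrE ?mulr_gt0 ?exprn_gt0 // !lnX //.
have -> : - (eps ^+ 2 * q * m%:R) / (1 - q) = - (m%:R * (eps ^+ 2 * q / (1 - q))).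
  by rewrite -mulrA mulNr; congr (- _); ring.
have {llr} := ler_wpM2l (ltW mR_gt0) llr.
set E := _ / (1 - q).
set x := q * m%:R * (1 + eps) in x_gt x_le.
have -> (u v : R) : m%:R * (q * (1 + eps) * u + (1 - q * (1 + eps)) * v) =
   x * u + (m%:R - x) * v by rewrite /x; ring.
move: x_gt x_le; move: (ln q) (ln (1 - q)) (ln r) (ln (1 - r)) (ln m%:R) lnq_le0
  lnq1_le0 odds_le lnm_ge0 => lq lq1 lr lr1 lm lq_le0 lq1_le0 odds_le lm_ge0.
move: {E}(m%:R * E) x => E x x_gt x_le llr.
(* Rounding multiplies the weight at [r] by [(r / (1 - r))^dl <= m] ([h3]) and the weight at [q] by
   [(q / (1 - q))^dl >= q] ([h1] and [h2]). *)
pose dl := k%:R - x.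
have [dl_ge0 dl_le1] : 0 <= dl /\ 0 <= 1 - dl by rewrite /dl; split; lra.
have h1 : (1 - dl) * lq <= 0 by rewrite mulr_ge0_le0.
have h2 : dl * lq1 <= 0 by rewrite mulr_ge0_le0.
have h3 : dl * (lr - lr1) <= lm.
  apply: le_trans (ler_wpM2l dl_ge0 odds_le) _.
  by rewrite ler_piMl //; lra.
rewrite /dl in h1 h2 h3; lra.
Qed.

(** * The binomial weight at [r] and the final estimate *)

(** Passing from [m] to [m + 1] trials at fixed [k] costs nothing: ['C(m, k) = 'C(m + 1, k) (m + 1 -
    k) / (m + 1)], and this last fraction is exactly the missing factor [1 - r]. *)
Lemma modal_mass_binomial (R : realFieldType) (m k : nat) (r : R) :
  (k <= m)%N -> r = k%:R / m.+1%:R ->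
  'C(m, k)%:R * (r ^+ k * (1 - r) ^+ (m - k)) = modal_mass R k (m.+1 - k).
Proof.
move=> k_le rE; rewrite /modal_mass (subnKC (leqW k_le)) subSn //.
have n_neq0 : m.+1%:R != 0 :> R by rewrite pnatr_eq0.
have binE : (m - k).+1%:R * 'C(m.+1, k)%:R = m.+1%:R * 'C(m, k)%:R :> R.
  by rewrite -!natrM mul_bin_down subSn.
have -> : 1 - r = (m - k).+1%:R / m.+1%:R.
  by rewrite rE -subSn // natrB ?leqW // mulrBl divff.
rewrite rE !expr_div_n mulrACA -invfM -exprD subnKC // !exprS.
rewrite [X in _ = X / _](_ : _ = (m - k).+1%:R * 'C(m.+1, k)%:R *
  (k%:R ^+ k * (m - k).+1%:R ^+ (m - k))); last by ring.
rewrite binE; have := expf_neq0 m n_neq0.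
move: (_ ^+ k * _) (m.+1%:R ^+ m) => K N N_neq0; clear binE.
move: m.+1%:R n_neq0 => M M_neq0; field; by rewrite N_neq0 M_neq0.
Qed.

(** The estimates yield the constant [1/2], which has to dominate the stated one. *)
Lemma constant_le_half (R : realType) : 1 / (4 * Num.sqrt (2 * pi)) <= 2^-1 :> R.
Proof.
have s_ge1 : 1 <= Num.sqrt (2 * pi) :> R.
  by rewrite -[leLHS]sqrtr1 ler_wsqrtr //; have := pi_ge2 R; lra.
by rewrite ler_pdivrMr; lra.
Qed.

Theorem theorem2 (R : realType) (d : measure_display) (T : measurableType d)
    (P : probability T R) (m : nat) (q : R) (A : 'I_m -> set T)
    (hm : (0 < m)%N) (hq0 : 0 < q) (hq1 : q < 1)
    (hA : mutually_independent P A)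
    (hAq : forall i : 'I_m, P (A i) = q%:E)
    (eps : R) (heps0 : 0 <= eps) (heps1 : eps < (1 - q) / q) :
  let c : R := 1 / (4 * Num.sqrt (2 * pi)) in
  ((c * q * m%:R `^ (- (3 / 2))
      * expR (- (eps ^+ 2 * q * m%:R) / (1 - q)))%:E
   <= P [set w : T | (#|selected A w|)%:Z = Num.ceil (q * m%:R * (1 + eps))])%E.
Proof.
cbv zeta; set c : R := 1 / _.
have mR_gt0 : 0 < m%:R :> R by rewrite ltr0n.
(* This form of the upper bound on [eps] gives [x <= m], hence [k <= m]. *)
have p_lt1 : q * (1 + eps) < 1.
  by move: heps1; rewrite ltr_pdivlMr //; lra.
set x := q * m%:R * (1 + eps).
have x_gt0 : 0 < x by rewrite !mulr_gt0 //; lra.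
have x_le : x <= m%:R by rewrite /x mulrAC ler_piMl // ltW.
have [k kE] : exists k : nat, Num.ceil x = k%:Z.
  by exists `|Num.ceil x|%N; rewrite gez0_abs // ltW // ceil_gt0.
have k_gt0 : (0 < k)%N by rewrite -ltz_nat -kE ceil_gt0.
have k_le : (k <= m)%N by rewrite -lez_nat -kE ceil_le_int.
have x_itv : k%:R - 1 <= x <= k%:R.
  by have /andP[] := ceil_itv x; rewrite kE intrB => /ltW ? ?; apply/andP.
rewrite kE (_ : [set w | _] = [set w | #|selected A w| = k]); last first.
  by apply/seteqP; split => w /= [->].
rewrite (probability_card_selected hA hAq) lee_fin card_ord.
have q01 : 0 < q < 1 by rewrite hq0.
have rounding := binomial_weight_change_of_parameter_le q01 heps0 p_lt1
  (introT andP (conj k_gt0 k_le)) x_itv erefl.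
have mass := modal_mass_binomial R m k _ k_le erefl.
have mass_ge : (2 * Num.sqrt m%:R)^-1 <= modal_mass R k (m.+1 - k).
  by apply: modal_mass_ge; lia.
set E := expR _ in rounding *; set r := k%:R / m.+1%:R in rounding mass.
(* The factor [m] comes from the rounding, [sqrt m] from the central binomial coefficient. *)
have powE : m%:R `^ (- (3 / 2)) = (m%:R * Num.sqrt m%:R)^-1 :> R.
  rewrite powRN (_ : 3 / 2 = 1 + 2^-1); last by field.
  by rewrite powRD ?powRr1 ?powR12_sqrt // ?ltW // gt_eqF ?implybT.
have s_gt0 : 0 < Num.sqrt m%:R :> R by rewrite sqrtr_gt0.
have E_ge0 : 0 <= q * E by rewrite mulr_ge0 ?expR_ge0 // ltW.
(* Multiplying by ['C(m, k)] turns the left side into a multiple of the modal mass and the right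
   side into [m] times the required probability. *)
have {rounding} := ler_wpM2l (ler0n R 'C(m, k)) rounding.
rewrite [leLHS]mulrCA mass [leRHS]mulrCA => /(le_trans (ler_wpM2l E_ge0 mass_ge)).
rewrite [leRHS]mulrC -ler_pdivrMr // => /(le_trans _); apply.
rewrite powE.
have -> : c * q / (m%:R * Num.sqrt m%:R) * E =
    c * (q * E / (m%:R * Num.sqrt m%:R)) by ring.
rewrite (_ : _ / m%:R = 2^-1 * (q * E / (m%:R * Num.sqrt m%:R))).
  by rewrite ler_wpM2r ?constant_le_half // divr_ge0 // mulr_ge0 // ltW.
rewrite !invfM; ring.
Qed.
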